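(* There is a syndetic set $A\subset\mathbb{N}$ with gaps of length two (that is, $\mathbb{N}\subset A\cup(A-1)\cup(A-2)$) such that $A$ does not contain any set $B+B+t$ for $B\subset\mathbb{N}$ infinite and $t\in\mathbb{N}$.
   Context: $\mathbb{N}=\{1,2,3,\dots\}$. $B+B+t=\{b_1+b_2+t : b_1,b_2\in B\}$ (the case $b_1=b_2$ is allowed). A set $A\subset\mathbb{N}$ is syndetic if there is $d\in\mathbb{N}$ such that $\mathbb{N}\subset A\cup(A-1)\cup\cdots\cup(A-d)$, where $A-j=\{a-j:a\in A\}$; $d$ is called the gap of $A$. *)

(* Defs.v *)
From mathcomp Require Import all_boot.
From mathcomp Require Import classical_sets cardinality.

Set Implicit Arguments.
Unset Strict Implicit.
Unset Printing Implicit Defensive.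

Local Open Scope nat_scope.
Local Open Scope classical_set_scope.

(* The natural numbers start at 1: subsets of N are the sets A : set nat with
   A `<=` Npos. *)
Definition Npos : set nat := [set n | 0 < n].

(* A - j, written as a preimage because nat subtraction is truncated. Any
   negative a - j is dropped; only the part of A - j inside Npos matters below. *)
Definition shiftl (A : set nat) (j : nat) : set nat := [set n | A (n + j)].

Definition has_gap (A : set nat) (d : nat) : Prop :=
  Npos `<=` \bigcup_(j in [set j | j <= d]) shiftl A j.

Definition syndetic (A : set nat) : Prop :=
  exists2 d : nat, Npos d & has_gap A d.

(* B + B + t; the two summands from B may coincide. *)
Definition sumset2 (B : set nat) (t : nat) : set nat :=
  [set b1 + b2 + t | b1 in B & b2 in B].

(* Main.v *)
Require Import Defs.
From mathcomp Require Import all_boot.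
From mathcomp Require Import classical_sets cardinality.
From mathcomp Require Import boolp zify.

(** The set [rotating_set] is, up to a patch at the ends of the scales, one
    residue class mod 3 on each scale [4^l <= n^3 < 4^(l+1)], namely the class
    of [-l]; it rotates each time [n] is multiplied by the cube root of 4.

    Doubling [n] multiplies [n^3] by 8, which lies strictly between 4 and 16.
    Hence the level [l] goes up by 1 or 2, never by a multiple of 3, and this
    remains true for any number that is only approximately [2 * n]
    ([level_double]).  If [B + B + t] were contained in the set, choose
    [b1] and [b2] in [B] that agree mod 3, with [b2] much larger than [b1].
    Then [b1 + b2 + t] and [2 * b2 + t] are elements of the set in the same
    residue class, so their levels agree mod 3; but their ratio is close to 2,
    which is impossible.

    Pure residue classes would leave too long a gap where the level changes.
    Letting [n] use either its own level or that of [n + 1] fills it, and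
    costs nothing because [level_double] tolerates small perturbations. *)

Local Open Scope nat_scope.
Local Open Scope classical_set_scope.

(** The integer part of the logarithm of [n] in base [4^(1/3)].  This base
    makes multiplication by 2 a shift by 3/2, the shift that stays as far as
    possible from the multiples of 3. *)
Definition level (n : nat) : nat := trunc_log 4 (n ^ 3).

Definition rotating_set : set nat :=
  [set n | 0 < n /\ (3 %| n + level n \/ 3 %| n + level n.+1)].

Lemma level_le (m n : nat) : m <= n -> level m <= level n.
Proof. by move=> le_mn; apply: leq_trunc_log; rewrite leq_exp2r. Qed.

Lemma level_succ (n : nat) : 0 < n -> level n.+1 <= (level n).+1.
Proof.
(* At n = 1 the cube is multiplied by 8, so the estimate below fails there. *)
case: n => [//|[|n]] _; first by [].
have cube_le : n.+3 ^ 3 <= 4 * n.+2 ^ 3 by rewrite !expnS !expn0; nia.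
rewrite /level -trunc_logMp ?expn_gt0 //.
exact: leq_trunc_log.
Qed.

(** The bounds are those with simple ratios: [(8/5)^3 > 4] makes the level
    increase, and [2^3 < 16] keeps the increase below 3. *)
Lemma level_double (x y : nat) :
  0 < x -> 8 * x <= 5 * y -> y <= 2 * x -> level x < level y < level x + 3.
Proof.
move=> x_gt0 le_xy le_yx; have y_gt0 : 0 < y by lia.
have cube_ge : 4 * x ^ 3 <= y ^ 3.
  have : (8 * x) ^ 3 <= (5 * y) ^ 3 by rewrite leq_exp2r.
  by rewrite !expnMn -[8 ^ 3]/512 -[5 ^ 3]/125; lia.
have cube_le : y ^ 3 <= 8 * x ^ 3.
  have : y ^ 3 <= (2 * x) ^ 3 by rewrite leq_exp2r.
  by rewrite expnMn.
apply/andP; split.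
  by rewrite /level -trunc_logMp ?expn_gt0 ?x_gt0 //; apply: leq_trunc_log.
rewrite -(ltn_exp2l _ _ (isT : 1 < 4)) addn3.
have y3_gt0 : 0 < y ^ 3 by rewrite expn_gt0 y_gt0.
apply: leq_ltn_trans (trunc_logP (isT : 1 < 4) y3_gt0) _.
rewrite (expnS 4 (level x).+2) (expnS 4 (level x).+1).
have : x ^ 3 < 4 ^ (level x).+1 by apply: trunc_log_ltn.
move: (4 ^ (level x).+1) => p; lia.
Qed.

(** The level never decreases and changes by at most 1.  If it goes from [l] to
    [l + 1] between [n] and [n + 1], then [n] is in the set unless it is in the
    class of [1 - l], and in that case [n + 1] is in the class of
    [2 - l = - (l + 1)] and hence in the set. *)
Lemma rotating_set_gap : has_gap rotating_set 2.
Proof.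
move=> n n_gt0; rewrite /Npos /= in n_gt0.
have le0 := level_le n n.+1 (leqnSn n); have le1 := level_succ n n_gt0.
have le2 := level_le n.+1 n.+2 (leqnSn _); have le3 := level_succ n.+1 isT.
have [hit|[hit|hit]] : (3 %| n + level n \/ 3 %| n + level n.+1) \/
    (3 %| n.+1 + level n.+1 \/ 3 %| n.+1 + level n.+2) \/
    3 %| n.+2 + level n.+2 by lia.
- by exists 0 => //; rewrite /shiftl /= addn0.
- by exists 1 => //; rewrite /shiftl /= addn1.
- by exists 2 => //; rewrite /shiftl /= addn2; split=> //; left.
Qed.

(** The one unit added to [x] or [y] accounts for elements that use the level
    of their successor. *)
Lemma rotating_set_double (x y : nat) :
  rotating_set x -> rotating_set y -> x = y %[mod 3] ->
  8 * x.+1 <= 5 * y -> y.+1 <= 2 * x -> False.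
Proof.
move=> [x_gt0 hx] [_ hy] xy_mod3 le_xy le_yx.
have apart (d e : nat) : d <= 1 -> e <= 1 ->
    level (x + d) < level (y + e) < level (x + d) + 3.
  by move=> d_le1 e_le1; apply: level_double; lia.
have := apart 0 0 isT isT; have := apart 0 1 isT isT.
have := apart 1 0 isT isT; have := apart 1 1 isT isT.
by rewrite !addn0 !addn1; lia.
Qed.

Lemma infinite_set_unbounded (B : set nat) (N : nat) :
  infinite_set B -> exists2 b, B b & N <= b.
Proof.
move=> B_inf; apply: contrapT => no_b; apply: B_inf.
apply: sub_finite_set (finite_II N) => b Bb /=.
by rewrite ltnNge; apply/negP => N_le_b; apply: no_b; exists b.
Qed.

Lemma infinite_set_congruent_pair (B : set nat) (c : nat) : infinite_set B ->
  exists b1 b2, [/\ B b1, B b2, b1 = b2 %[mod 3] & 4 * b1 + c <= b2].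
Proof.
move=> B_inf.
have [w Bw _] := infinite_set_unbounded B 0 B_inf.
have [x Bx wx] := infinite_set_unbounded B (4 * w + c) B_inf.
have [y By xy] := infinite_set_unbounded B (4 * x + c) B_inf.
have [z Bz yz] := infinite_set_unbounded B (4 * y + c) B_inf.
have [e|[e|[e|[e|[e|e]]]]] : w = x %[mod 3] \/ w = y %[mod 3] \/
    w = z %[mod 3] \/ x = y %[mod 3] \/ x = z %[mod 3] \/ y = z %[mod 3] by lia.
- by exists w, x.
- by exists w, y; split=> //; lia.
- by exists w, z; split=> //; lia.
- by exists x, y.
- by exists x, z; split=> //; lia.
- by exists y, z.
Qed.

Theorem proposition5p1 :
  exists A : set nat,
    [/\ A `<=` Npos, syndetic A, has_gap A 2 &
        ~ exists (B : set nat) (t : nat),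
            [/\ B `<=` Npos, infinite_set B, Npos t & sumset2 B t `<=` A]].
Proof.
exists rotating_set; split.
- by move=> n [].
- by exists 2; last exact: rotating_set_gap.
- exact: rotating_set_gap.
move=> [B [t [_ B_inf t_gt0 sub_A]]]; rewrite /Npos /= in t_gt0.
have [b1 [b2 [Bb1 Bb2 b_mod3 b1_ll_b2]]] :=
  infinite_set_congruent_pair B (2 * t + 4) B_inf.
apply: (rotating_set_double (b1 + b2 + t) (b2 + b2 + t)); last 3 first.
- lia.
- lia.
- lia.
- by apply: sub_A; exists b1 => //; exists b2.
- by apply: sub_A; exists b2 => //; exists b2.
Qed.
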